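(* If $P$ is a finite $(2+2)$-free poset, then $$L_P=\sum_{\sigma\in\mathfrak{S}(\mathrm{inc}(P))}p_{\mathrm{type}(\sigma)}.$$
   Context: A poset is $(2+2)$-free if it contains no induced subposet isomorphic to the disjoint union of two chains with $2$ elements each. The incomparability graph $\mathrm{inc}(P)$ is the graph with vertex set $P$ in which $\{i,j\}$ is an edge iff $i$ and $j$ are incomparable in $P$. For a graph $G=(V,E)$, $\mathfrak{S}(G)$ is the set of all permutations $\sigma$ of $V$ such that the elements of each cycle in the cycle decomposition of $\sigma$ form a clique of $G$ (any two distinct elements adjacent; fixed points count as cycles). $\mathrm{type}(\sigma)$ is the partition whose parts are the cycle lengths of $\sigma$. $p_\lambda=p_{\lambda_1}\cdots p_{\lambda_k}$ with $p_i=\sum_{j\ge1}x_j^i$ is the power sum symmetric function. $\zeta(P)$ is the number of linear extensions of a finite poset $P$, i.e. of lists $(\omega_1,\dots,\omega_n)$ of all elements of $P$ without repetition with no $i<j$ such that $\omega_j\le_P\omega_i$. The linear function of $P$ is $L_P=\sum\zeta(P_1)\cdots\zeta(P_k)M_{(|P_1|,\dots,|P_k|)}$, the sum being over all set compositions (ordered set partitions into nonempty blocks) $(P_1,\dots,P_k)$ of $P$, each block with the induced order, where $M_\alpha=\sum_{i_1<\cdots<i_k}x_{i_1}^{\alpha_1}\cdots x_{i_k}^{\alpha_k}$. It is the image of $P$ under the canonical morphism to $QSym$ from the Hopf algebra of posets (product: ordinal sum; coproduct: $P\mapsto\sum_S P|_S\otimes P|_{P\setminus S}$) with character $\zeta$;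 coefficients are in a field of characteristic $0$. *)

(* Defs.v *)
From HB Require Import structures.
From mathcomp Require Import all_boot all_order all_algebra all_fingroup.
From mathcomp Require Import finmap boolp classical_sets functions cardinality
  fsbigop.
From mathcomp.multinomials Require Import monalg.

Set Implicit Arguments.
Unset Strict Implicit.
Unset Printing Implicit Defensive.

Import Order.TTheory GRing.Theory.
Local Open Scope ring_scope.

Notation "1" := (@mone _) : monom_scope.
Notation "x * y" := (mmul x y) : monom_scope.

(** Monomials in the variables [x_0, x_1, x_2, ...]. *)
Notation monom := {cmonom nat}.

Section Splits.
Variable m : monom.

Definition split_set : set (monom * monom) :=
  [set ab | (ab.1 * ab.2)%M = m]%classic.

Lemma monom_le_finite : finite_set [set a : monom | forall i, (a i <= m i)%N]%classic.
Proof.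
pose N := \max_(i : finsupp m) m (val i).
pose g (f : {ffun finsupp m -> 'I_N.+1}) : monom := [cmonom (f i : nat) | i : finsupp m]%M.
apply: (@sub_finite_set _ _ (g @` [set: _])%classic); last first.
  exact: finite_image.
move=> a /= am.
have aN (i : finsupp m) : (a (val i) < N.+1)%N.
  by rewrite ltnS (leq_trans (am _)) // /N (bigD1 i) //= leq_maxl.
exists [ffun i => Ordinal (aN i)] => //.
apply/eqP/cmP => i; rewrite /g cmE /= fsfun_ffun.
case: insubP => [u _ <-|ni] /=; first by rewrite ffunE.
by move: (am i); rewrite [m i]fsfun_dflt // leqn0 => /eqP.
Qed.

Lemma split_set_finite : finite_set split_set.
Proof.
have F := monom_le_finite.
apply: (sub_finite_set _ (finite_setX F F)) => -[a b] /= <-.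
by split=> i /=; rewrite cmM ?leq_addr ?leq_addl.
Qed.

Definition splits : seq (monom * monom) := fset_set split_set.

Lemma mem_splits ab : (ab \in splits) = ((ab.1 * ab.2)%M == m).
Proof.
rewrite /splits in_fset_set; last exact: split_set_finite.
by apply/idP/eqP; rewrite inE.
Qed.

Lemma splits_uniq : uniq splits.
Proof. exact: fset_uniq. Qed.

End Splits.

(** [f : fps F] maps a monomial to its coefficient.  The definition is kept
    distinct from [monom -> F], which carries the pointwise product. *)
Definition fps (F : fieldType) : Type := monom -> F.

HB.instance Definition _ (F : fieldType) := GRing.Zmodule.copy (fps F) (monom -> F).

Section FpsRing.
Variable F : fieldType.
Implicit Types f g h : fps F.

Definition mono (a : monom) : fps F := fun m => (m == a)%:R.

Definition fps_mul f g : fps F :=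
  fun m => \sum_(ab <- splits m) f ab.1 * g ab.2.

Lemma fps_mulC : commutative fps_mul.
Proof.
move=> f g; apply/funext => m; rewrite /fps_mul.
pose sw (ab : monom * monom) := (ab.2, ab.1).
have swK : involutive sw by case.
rewrite -(perm_big _ (_ : perm_eq (map sw (splits m)) _)) /=; last first.
  apply: uniq_perm; rewrite ?(map_inj_uniq (inv_inj swK)) ?splits_uniq //.
  by move=> ab; rewrite -[ab in LHS]swK (mem_map (inv_inj swK)) !mem_splits mulmC.
by rewrite big_map; apply: eq_bigr => ab _; rewrite mulrC.
Qed.

Lemma fps_mulA : associative fps_mul.
Proof.
move=> f g h; apply/funext => m; rewrite /fps_mul.
under eq_bigr do rewrite big_distrr /=.
under [in RHS]eq_bigr do rewrite big_distrl /=.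
pose r1 (p : (monom * monom) * (monom * monom)) := ((p.1.1 * p.2.1)%M, p.2.2, (p.1.1, p.2.1)).
pose s1 := [seq (ab, cd) | ab <- splits m, cd <- splits ab.2].
pose s2 := [seq (ab, cd) | ab <- splits m, cd <- splits ab.1].
have u1 : uniq s1.
  apply: allpairs_uniq_dep => [|ab _|[a b] [a' b'] _ _ /= []]; rewrite ?splits_uniq //.
  by move=> -> ->.
have u2 : uniq s2.
  apply: allpairs_uniq_dep => [|ab _|[a b] [a' b'] _ _ /= []]; rewrite ?splits_uniq //.
  by move=> -> ->.
have m1 p : (p \in s1) = ((p.1.1 * p.1.2)%M == m) && ((p.2.1 * p.2.2)%M == p.1.2).
  apply/allpairsPdep/andP => [[ab [cd [+ + ->]]] | [A B]].
    by rewrite !mem_splits.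
  by exists p.1, p.2; rewrite !mem_splits -surjective_pairing.
have m2 p : (p \in s2) = ((p.1.1 * p.1.2)%M == m) && ((p.2.1 * p.2.2)%M == p.1.1).
  apply/allpairsPdep/andP => [[ab [cd [+ + ->]]] | [A B]].
    by rewrite !mem_splits.
  by exists p.1, p.2; rewrite !mem_splits -surjective_pairing.
have P : perm_eq (map r1 s1) s2.
  apply: uniq_perm => //.
    rewrite map_inj_in_uniq // => -[[a b] [c d]] [[a' b'] [c' d']].
    rewrite !m1 /= => /andP[_ /eqP <-] /andP[_ /eqP <-] [_ e3 e4 e5].
    by rewrite e3 e4 e5.
  move=> -[[a b] [c d]]; apply/mapP/idP => [[[[a' b'] [c' d']]]|].
    rewrite m1 m2 /r1 /= => /andP[/eqP <- /eqP <-] [-> -> -> ->].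
    by rewrite mulmA !eqxx.
  rewrite m2 /= => /andP[/eqP e1 /eqP e2].
  exists ((c, (d * b)%M), (d, b)); last by rewrite /r1 /= e2.
  by rewrite m1 /= mulmA e2 e1 !eqxx.
transitivity (\sum_(p <- s1) f p.1.1 * (g p.2.1 * h p.2.2)).
  by rewrite big_allpairs_dep.
transitivity (\sum_(p <- s2) f p.2.1 * g p.2.2 * h p.1.2).
  by rewrite -(perm_big _ P) big_map; apply: eq_bigr => p _ /=; rewrite mulrA.
by rewrite big_allpairs_dep.
Qed.

Lemma fps_mul1 : left_id (mono 1%M) fps_mul.
Proof.
move=> f; apply/funext => m; rewrite /fps_mul.
rewrite (bigD1_seq (1%M, m)) ?splits_uniq ?mem_splits ?mul1m //=.
rewrite /mono eqxx mul1r big_seq_cond big1 ?addr0 // => -[a b] /=.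
rewrite mem_splits /= => /andP[/eqP <-].
by case: (a =P 1%M) => [-> |]; rewrite ?mul0r // mul1m eqxx.
Qed.

Lemma fpsD f g m : (f + g) m = f m + g m.
Proof. by []. Qed.

Lemma fps_mulDl : left_distributive fps_mul +%R.
Proof.
move=> f g h; apply/funext => m; rewrite fpsD /fps_mul -big_split.
by apply: eq_bigr => ab _; rewrite fpsD mulrDl.
Qed.

Lemma fps_1neq0 : mono 1%M != 0.
Proof.
apply/eqP => /(congr1 (fun f : fps F => f 1%M)); rewrite /mono eqxx.
by move/eqP; rewrite oner_eq0.
Qed.

HB.instance Definition _ := GRing.Zmodule_isComNzRing.Build (fps F)
  fps_mulA fps_mulC fps_mul1 fps_mulDl fps_1neq0.

Lemma fpsM f g m : (f * g) m = \sum_(ab <- splits m) f ab.1 * g ab.2.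
Proof. by []. Qed.

Lemma fps1E : 1 = mono 1%M :> fps F.
Proof. by []. Qed.

Lemma monoM a b : mono a * mono b = mono (a * b)%M.
Proof.
apply/funext => m; rewrite fpsM /mono; have [->|ne] := eqVneq.
  rewrite (bigD1_seq (a, b)) ?splits_uniq ?mem_splits //= !eqxx mulr1.
  rewrite big1 ?addr0 // => -[c d]; rewrite xpair_eqE /=.
  by case: eqP; case: eqP; rewrite ?mulr0 ?mul0r.
rewrite big_seq big1 // => -[c d]; rewrite mem_splits /= => /eqP e.
case: eqP => [ec|]; case: eqP => [ed|]; rewrite ?mulr0 ?mul0r //.
by move: ne; rewrite -e ec ed eqxx.
Qed.

Definition var (j : nat) : fps F := mono (ucm j).

(** Infinite sum of series, computed coefficientwise; the coefficient at [m] is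
    meaningful when only finitely many terms have a nonzero coefficient at [m],
    see [power_sum_summable] and [qmonomial_summable]. *)
Definition fps_sum (I : choiceType) (D : set I) (f : I -> fps F) : fps F :=
  fun m => \sum_(i \in D) f i m.

Definition summable (I : choiceType) (D : set I) (f : I -> fps F) :=
  forall m, finite_set [set i | D i /\ f i m != 0]%classic.

Definition power_sum (i : nat) : fps F :=
  fps_sum [set: nat]%classic (fun j => var j ^+ i).

Definition power_sum_part (la : seq nat) : fps F :=
  \prod_(i <- la) power_sum i.

Definition increasing (k : nat) : set (k.-tuple nat) :=
  [set i | sorted ltn i]%classic.

Definition qmonomial_term (al : seq nat) (i : (size al).-tuple nat) : fps F :=
  \prod_(k < size al) var (tnth i k) ^+ nth 0%N al k.

Definition qmonomial (al : seq nat) : fps F :=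
  fps_sum (@increasing (size al)) (@qmonomial_term al).

Lemma varX_mono j i : var j ^+ i = mono (iterop i (@mmul monom) (ucm j) 1%M).
Proof.
case: i => [|i]; first by rewrite expr0.
elim: i => // i IH; rewrite exprS IH monoM //.
Qed.

Lemma iter_ucm j i : iterop i (@mmul monom) (ucm j) 1%M j = i.
Proof.
case: i => [|i]; first by rewrite cm1.
elim: i => [|i IH]; first exact: cmUU.
by rewrite [LHS]cmM cmUU IH.
Qed.

Lemma power_sum_summable i : (0 < i)%N ->
  summable [set: nat]%classic (fun j => var j ^+ i).
Proof.
move=> i0 m; apply: (@sub_finite_set _ _ [set` finsupp m]%classic) => //.
move=> j /= [_]; rewrite varX_mono /mono; case: (m =P _) => [->|]; last by rewrite eqxx.
by rewrite mem_finsupp iter_ucm -lt0n i0.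
Qed.

Lemma mono_prod (I : Type) (r : seq I) (a : I -> monom) :
  \prod_(k <- r) mono (a k) = mono (\big[@mmul monom/1%M]_(k <- r) a k).
Proof.
elim: r => [|k r IH]; first by rewrite !big_nil fps1E.
by rewrite !big_cons IH monoM.
Qed.

Lemma qmonomial_summable (al : seq nat) : all (leq 1) al ->
  summable (@increasing (size al)) (@qmonomial_term al).
Proof.
move=> al0 m.
pose g (t : (size al).-tuple (finsupp m)) : (size al).-tuple nat := map_tuple val t.
apply: (@sub_finite_set _ _ (g @` [set: _])%classic); last exact: finite_image.
move=> i /= [_]; rewrite /qmonomial_term.
under eq_bigr do rewrite varX_mono.
rewrite mono_prod /mono; case: (m =P _) => [em _|]; last by rewrite eqxx.
have im k : tnth i k \in finsupp m.
  rewrite mem_finsupp em (bigD1 k) //= cmM iter_ucm -lt0n addn_gt0.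
  by rewrite (allP al0) // mem_nth.
exists [tuple FSetSub (im k) | k < size al] => //.
by apply: eq_from_tnth => k; rewrite tnth_map tnth_mktuple.
Qed.

End FpsRing.

Section Graph.
Variables (V : finType) (e : rel V).

Definition clique (C : {set V}) : bool :=
  [forall x in C, forall y in C, (x != y) ==> e x y].

Definition clique_perms : {set {perm V}} :=
  [set s : {perm V} | [forall C in porbits s, clique C]].

Definition cycle_type (s : {perm V}) : seq nat :=
  sort geq [seq #|C| | C : {set V} <- enum (porbits s)].

End Graph.

Section Poset.
Variables (d : Order.disp_t) (P : finPOrderType d).

Definition two_plus_two_le : rel ('I_2 + 'I_2) := fun x y =>
  match x, y with
  | inl a, inl b | inr a, inr b => (a <= b)%N
  | _, _ => false
  end.

(** An order embedding is injective, so its image is an induced copy. *)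
Definition two_plus_two_free : Prop :=
  ~ exists f : 'I_2 + 'I_2 -> P,
      forall x y, (f x <= f y)%O = two_plus_two_le x y.

Definition inc : rel P := fun x y => (x >< y)%O.

Definition linear_extensions (S : {set P}) : {set #|S|.-tuple P} :=
  [set w : #|S|.-tuple P |
     perm_eq w (enum S) && pairwise (fun x y => ~~ (y <= x)%O) w].

Definition zeta (S : {set P}) : nat := #|linear_extensions S|.

Definition set_composition (B : seq {set P}) : bool :=
  uniq B && finset.partition [set X in B] [set: P].

Lemma set_composition_size B : set_composition B -> (size B <= #|P|)%N.
Proof.
case/andP=> uB /and3P[/eqP cB tB B0].
have -> : size B = #|[set X in B]| by rewrite cardsE; apply/esym/card_uniqP.
rewrite -cardsT -cB -(eqP tB) -sum1_card leq_sum // => X XB.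
by rewrite card_gt0; apply: contraNneq B0 => <-.
Qed.

(** The outer index is the number of blocks, at most [#|P|] by
    [set_composition_size]. *)
Definition linear_function (F : fieldType) : fps F :=
  \sum_(k < #|P|.+1) \sum_(B : k.-tuple {set P} | set_composition B)
    qmonomial F [seq #|X| | X : {set P} <- B] *+ \prod_(X <- B) zeta X.

End Poset.

(* Main.v *)
(** Since specializing all but finitely many variables to zero loses nothing at a
given monomial, both sides become polynomials.  Expanding the power sums, the
right side is a sum over colorings [c] of [P] of the monomial of [c] times the
number of [sigma] preserving the colors; a set composition together with an
increasing tuple of indices is also a coloring, so the left side is the sum of the
same monomials weighted by the product of the [zeta] of the color classes.

The weights agree because they obey the same recurrence.  In a (2+2)-free poset
[T] an element [a] with the largest strict down-set is incomparable exactly to the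
other maximal elements.  Removing the last letter of a linear extension gives
[zeta T] as the sum of [zeta (T - y)] over the maximal [y]; for permutations,
deleting [y = sigma a] from its cycle does the same, because the cycle
of [a] may contain any set of maximal elements. *)

Require Import Defs.
From mathcomp Require Import finmap boolp classical_sets fsbigop.
From mathcomp.multinomials Require Import monalg.
From mathcomp Require Import all_boot all_order all_algebra all_fingroup.

Set Implicit Arguments.
Unset Strict Implicit.
Unset Printing Implicit Defensive.

Import Order.TTheory GRing.Theory.
Local Open Scope ring_scope.

Section CliquePermutations.
Variables (V : finType) (e : rel V).
Implicit Types (s t : {perm V}) (S A : {set V}).

Lemma porbit_subset s A x :
  x \in A -> {in A, forall z, s z \in A} -> porbit s x \subset A.
Proof.
move=> xA sA; apply/subsetP => _ /porbitP[i ->]; rewrite permX.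
by elim: i => // i IH; rewrite iterS sA.
Qed.

Lemma perm_porbit s x y : (s y \in porbit s x) = (y \in porbit s x).
Proof. by rewrite -!eq_porbit_mem -[s y]/((s ^+ 1)%g y) porbit_perm. Qed.

Lemma clique_permsP s :
  reflect (forall x y, y \in porbit s x -> x != y -> e x y)
          (s \in clique_perms e).
Proof.
rewrite inE; apply: (iffP forall_inP) => [H x y yx | H _ /imsetP[u _ ->]].
  have /forall_inP/(_ x (porbit_id s x)) := H _ (imset_f (porbit s) (isT : x \in V)).
  by move=> /forall_inP/(_ y yx)/implyP.
apply/forall_inP => x xu; apply/forall_inP => y yu; apply/implyP; apply: H.
by move: xu; rewrite -eq_porbit_mem => /eqP ->.
Qed.

Definition clique_perms_on S := [set s in clique_perms e | perm_on S s].

Lemma clique_perms_onT : clique_perms_on [set: V] = clique_perms e.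
Proof.
apply/setP => s; rewrite inE andb_idr // => _.
exact/subsetP.
Qed.

Lemma clique_perms_on0 : clique_perms_on set0 = [set 1%g].
Proof.
apply/setP => s; rewrite !inE; apply/andP/eqP => [[_ s0]|->].
  by apply/permP => x; rewrite perm1 (out_perm s0) ?inE.
split; last exact: perm_on1.
suff: 1%g \in clique_perms e by rewrite inE.
apply/clique_permsP => x y yx; suff: y \in [set x] by move/set1P ->; rewrite eqxx.
apply: subsetP yx; apply: porbit_subset => [|z]; first exact: set11.
by rewrite perm1.
Qed.

(* Multiplication by [tperm a y] deletes [y] from the cycle of [a] in a
   permutation sending [a] to [y], or inserts it back; the insertion preserves
   cliques because the cycle of [a] lies in the closed neighbourhood of [a]. *)
Lemma clique_perms_on_tperm S a y t :
    let N := [set y in S | (y == a) || e a y] in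
    a \in S -> clique e N -> y \in N ->
  ((tperm a y * t)%g \in clique_perms_on S) && (t y == y) =
  (t \in clique_perms_on (S :\ y)).
Proof.
move=> N aS /forall_inP cN yN; have yS : y \in S by case/setIdP: yN.
have aN : a \in N by rewrite inE aS eqxx.
rewrite [in LHS]inE [in RHS]inE.
apply/andP/andP => [[/andP[/clique_permsP sP sS] /eqP ty]|].
  split.
    apply/clique_permsP => u v vu; apply: sP; apply: subsetP vu.
    apply: porbit_subset => [|z]; first exact: porbit_id.
    have -> : t z = (tperm a y * t)%g (tperm a y z) by rewrite permM tpermK.
    have ya : (y \in porbit (tperm a y * t) u) = (a \in porbit (tperm a y * t) u).
      by rewrite -[in RHS]perm_porbit permM tpermL ty.
    by case: tpermP => [->|->|_ _]; rewrite perm_porbit ?ya.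
  apply/subsetP => x; rewrite !inE => tx; apply/andP; split.
    by apply: contraNneq tx => ->; rewrite ty.
  apply: contraR tx => xS; rewrite -[in X in _ == X](out_perm sS xS) permM tpermD //.
  - by apply: contraNneq xS => <-.
  - by apply: contraNneq xS => <-.
case=> /clique_permsP tP tS.
have ty : t y = y by rewrite (out_perm tS) // !inE eqxx.
rewrite ty eqxx; split => //; apply/andP; split; last first.
  apply/subsetP => x; rewrite inE; apply: contraR => xS.
  rewrite permM tpermD; last 2 first.
  - by apply: contraNneq xS => <-.
  - by apply: contraNneq xS => <-.
  by rewrite (out_perm tS) // !inE (negPf xS) andbF.
pose A := y |: porbit t a.
have AN : A \subset N.
  rewrite subUset sub1set yN; apply/subsetP => z za.
  have [-> //|az] := eqVneq z a; rewrite inE (negPf az) /= tP 1?eq_sym //.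
  rewrite andbT; apply: contraR az => zS.
  have H (B : {set V}) : porbit t z \subset B -> a \in B.
    by move/subsetP; apply; rewrite porbit_sym.
  have : a \in [set z].
    apply: H; apply: porbit_subset; first exact: set11.
    by move=> _ /set1P ->; rewrite (out_perm tS) ?set11 // !inE (negPf zS) andbF.
  by rewrite inE eq_sym.
have sA z : (tperm a y * t)%g z = t z \/ (z \in A) && ((tperm a y * t)%g z \in A).
  rewrite permM; case: tpermP => [->|->|_ _]; last by left.
    by right; rewrite ty !inE porbit_id eqxx orbT.
  by right; rewrite !inE eqxx perm_porbit porbit_id orbT.
have tA z : (t z \in A) = (z \in A).
  by rewrite !inE -{1}ty (inj_eq perm_inj) perm_porbit.
apply/clique_permsP => u v vu uv.
have [uA|uA] := boolP (u \in A).
  have vA : v \in A.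
    apply: subsetP vu; apply: porbit_subset => // z zA.
    by case: (sA z) => [->|/andP[]//]; rewrite tA.
  by move: (cN _ (subsetP AN _ uA)) => /forall_inP/(_ _ (subsetP AN _ vA))/implyP; apply.
apply: tP => //.
suff: v \in porbit t u :\: A by case/setDP.
apply: subsetP vu; apply: porbit_subset => [|z /setDP[zu zA]].
  by rewrite inE uA porbit_id.
case: (sA z) => [->|/andP[]]; last by rewrite (negPf zA).
by rewrite inE tA zA perm_porbit.
Qed.

Lemma card_clique_perms_on S a :
    let N := [set y in S | (y == a) || e a y] in
    a \in S -> clique e N ->
  #|clique_perms_on S| = (\sum_(y in N) #|clique_perms_on (S :\ y)|)%N.
Proof.
move=> N aS cN; rewrite -sum1_card.
rewrite (partition_big (fun s : {perm V} => s a) (mem N)) => [|s] /=; last first.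
  rewrite inE => /andP[/clique_permsP sP sS].
  rewrite inE perm_closed // aS /=; case: eqVneq => //= sa.
  by rewrite sP ?perm_porbit ?porbit_id // eq_sym.
apply: eq_bigr => y yN; rewrite -sum1_card (reindex_inj (mulgI (tperm a y))).
apply: eq_bigl => t; rewrite permM tpermL.
exact: clique_perms_on_tperm.
Qed.

End CliquePermutations.

Section LinearExtensions.
Variables (d : Order.disp_t) (P : finPOrderType d).
Implicit Types (S T : {set P}) (w : seq P).

Definition max_elements S := [set y in S | [forall z in S, ~~ (y < z)%O]].

Definition linear_extension_seqs S :=
  [seq w <- permutations (enum S) | pairwise (fun x y => ~~ (y <= x)%O) w].

Lemma zetaE S : zeta S = size (linear_extension_seqs S).
Proof.
have U : uniq [seq tval t | t <- enum (linear_extensions S)].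
  by rewrite map_inj_uniq ?enum_uniq //; apply: val_inj.
rewrite /zeta cardE -(size_map (@tval _ _)); apply/perm_size/uniq_perm => //.
  exact/filter_uniq/permutations_uniq.
move=> w; rewrite mem_filter mem_permutations andbC.
apply/mapP/andP => [[t]|[wS pw]]; first by rewrite mem_enum inE => /andP[tS pt] ->.
have ws : size w == #|S| by rewrite cardE (perm_size wS).
by exists (Tuple ws); rewrite // mem_enum inE; apply/andP.
Qed.

Lemma zeta0 : zeta (set0 : {set P}) = 1%N.
Proof. by rewrite zetaE /linear_extension_seqs enum_set0. Qed.

Lemma perm_enumD1 S y : y \in S -> perm_eq (rcons (enum (S :\ y)) y) (enum S).
Proof.
move=> yS; apply: uniq_perm; rewrite ?rcons_uniq ?enum_uniq //.
  by rewrite mem_enum !inE eqxx.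
move=> x; rewrite mem_rcons inE !mem_enum !inE.
by case: eqVneq => [->|].
Qed.

Lemma zeta_rec S : S != set0 ->
  zeta S = (\sum_(y in max_elements S) zeta (S :\ y))%N.
Proof.
move=> S0; pose r := [seq rcons w y | y <- enum (max_elements S),
  w <- linear_extension_seqs (S :\ y)].
have -> : (\sum_(y in max_elements S) zeta (S :\ y))%N = size r.
  rewrite size_allpairs_dep sumnE big_map -big_enum.
  by apply: eq_bigr => y _; rewrite zetaE.
rewrite zetaE; apply/perm_size/uniq_perm => [||w].
- exact/filter_uniq/permutations_uniq.
- apply: allpairs_uniq_dep; first exact: enum_uniq.
    by move=> y _; apply/filter_uniq/permutations_uniq.
  by move=> [y w] [y' w'] _ _ /= /rcons_inj[-> ->].
rewrite mem_filter mem_permutations; apply/andP/allpairsPdep => [[]|].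
  case/lastP: w => [_ /perm_mem wS|w y].
    by case/set0Pn: S0 => x; rewrite -mem_enum -wS.
  rewrite pairwise_rcons => /andP[/allP yw pw] wS.
  have wS' x : (x \in S) = (x \in rcons w y) by rewrite (perm_mem wS) mem_enum.
  have yS : y \in S by rewrite wS' mem_rcons mem_head.
  exists y, w; split=> //; last first.
    rewrite mem_filter pw mem_permutations /=.
    rewrite -(perm_cat2r [:: y]) !cats1 (perm_trans wS) // perm_sym.
    exact: perm_enumD1.
  rewrite mem_enum inE yS; apply/forall_inP => x.
  rewrite wS' mem_rcons inE => /orP[/eqP->|/yw]; first by rewrite ltxx.
  by apply: contra; apply: ltW.
case=> y [w' [+ + ->]]; rewrite mem_enum inE => /andP[yS /forall_inP yM].
rewrite mem_filter mem_permutations => /andP[pw wS].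
have wS' : perm_eq (rcons w' y) (enum S).
  by apply: perm_trans (perm_enumD1 yS); rewrite -!cats1 perm_cat2r.
split => //; rewrite pairwise_rcons pw andbT; apply/allP => x.
rewrite (perm_mem wS) mem_enum !inE => /andP[xy xS].
by rewrite le_eqVlt eq_sym (negPf xy) yM.
Qed.

Hypothesis freeP : two_plus_two_free P.

(* In a (2+2)-free poset the strict down-sets form a chain, so an element with the
   largest one lies above every non-maximal element. *)
Lemma max_elements_witness T : T != set0 ->
  exists2 a, a \in T & {in T, forall x, (x \in max_elements T) || (x < a)%O}.
Proof.
move=> T0; pose D x := [set z in T | (z < x)%O].
have [a aT aD] : exists2 a, a \in T & forall x, x \in T -> (#|D x| <= #|D a|)%N.
  case/set0Pn: T0 => x0 x0T; exists [arg max_(x > x0 in T) #|D x|].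
    by case: arg_maxnP.
  by case: arg_maxnP.
exists a => // x xT; rewrite inE xT /=; apply/norP => -[].
rewrite negb_forall_in => /exists_inP[z zT]; rewrite negbK => xz nxa.
have [b] : exists b, b \in D a :\: D z.
  apply/set0Pn; apply: contra nxa; rewrite setD_eq0 => sD.
  have /eqP/setP/(_ x) : D a == D z by rewrite eqEcard sD aD.
  by rewrite !inE xT xz.
rewrite !inE => /andP[+ /andP[bT ba]]; rewrite bT /= => nbz.
apply: freeP.
exists (fun u : 'I_2 + 'I_2 => match u with
  | inl i => if i == ord0 then b else a
  | inr i => if i == ord0 then x else z end).
have ab : (a <= b)%O = false by exact: lt_geF.
have zx : (z <= x)%O = false by exact: lt_geF.
have ax : (a <= x)%O = false.
  by apply: contraNF nbz => ax; apply: lt_trans xz; apply: lt_le_trans ax.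
have az : (a <= z)%O = false by apply: contraNF nbz; apply: lt_le_trans.
have bx : (b <= x)%O = false by apply: contraNF nbz => bx; apply: le_lt_trans xz.
have xb : (x <= b)%O = false by apply: contraNF nxa => xb; apply: le_lt_trans ba.
have zb : (z <= b)%O = false.
  by apply: contraNF nxa => zb; apply: lt_trans ba; apply: lt_le_trans zb.
have za : (z <= a)%O = false by apply: contraNF nxa; apply: lt_le_trans.
have xa : (x <= a)%O = false.
  by rewrite le_eqVlt (negPf nxa) orbF; apply/negP => /eqP xa; rewrite xa lexx in ax.
have bz : (b <= z)%O = false.
  by rewrite le_eqVlt (negPf nbz) orbF; apply/negP => /eqP bz; rewrite bz lexx in zb.
by move=> [[[|[|//]] ?]|[[|[|//]] ?]] [[[|[|//]] ?]|[[|[|//]] ?]] /=;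
  rewrite ?lexx ?(ltW ba) ?(ltW xz).
Qed.

Section Coloring.
Variables (C : finType) (c : P -> C).

Definition inc_mono : rel P := fun x y => inc x y && (c x == c y).

Lemma card_clique_perms_on_mono S :
  #|clique_perms_on inc_mono S| = (\prod_j zeta (S :&: c @^-1: [set j]))%N.
Proof.
elim: {S}_.+1 {-2}S (ltnSn #|S|) => // n IH S Sn.
have [->|/set0Pn[x xS]] := eqVneq S set0.
  rewrite clique_perms_on0 cards1 big1 // => j _.
  by rewrite set0I zeta0.
pose T := S :&: c @^-1: [set c x].
have T0 : T != set0 by apply/set0Pn; exists x; rewrite !inE xS /=.
have [a aT aM] := max_elements_witness T0.
have TS y : y \in T = (y \in S) && (c y == c x) by rewrite !inE.
have /andP[aS /eqP ca] : (a \in S) && (c a == c x) by rewrite -TS.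
have EN : [set y in S | (y == a) || inc_mono a y] = max_elements T.
  have nlt y : y \in max_elements T -> ~~ (y < a)%O.
    by rewrite inE => /andP[_ /forall_inP]; apply.
  apply/setP => y; apply/idP/idP => [|yM].
    rewrite inE /inc_mono ca => /andP[yS ya].
    have /aM/orP[//|ya'] : y \in T.
      by rewrite TS yS; case/orP: ya => [/eqP->|/andP[_]]; rewrite ?ca ?eqxx // eq_sym.
    case/orP: ya => [/eqP ya|/andP[]]; first by rewrite ya ltxx in ya'.
    by rewrite /inc /Order.comparable (ltW ya') orbT.
  have /andP[yS /eqP cy] : (y \in S) && (c y == c x).
    by rewrite -TS; move: yM; rewrite inE => /andP[].
  rewrite inE yS /inc_mono ca cy eqxx andbT /=; case: eqVneq => //= ya.
  have ay := eq_sym a y; rewrite (negPf ya) in ay.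
  rewrite /inc /Order.comparable !le_eqVlt ay (negPf ya) (negPf (nlt y yM)) orbF /=.
  rewrite orbF; apply/negP => ltay.
  have := aM _ aT; rewrite ltxx orbF inE => /andP[_ /forall_inP].
  by move=> /(_ y); rewrite ltay TS yS cy eqxx => /(_ isT).
have cN : clique inc_mono (max_elements T).
  apply/forall_inP => y yM; apply/forall_inP => z zM; apply/implyP => yz.
  move: yM zM; rewrite !inE.
  case/andP=> /andP[yS /eqP cy] /forall_inP yM /andP[/andP[zS /eqP cz] /forall_inP zM].
  rewrite /inc_mono cy cz eqxx andbT /inc /Order.comparable !le_eqVlt.
  rewrite (eq_sym z) (negPf yz) /=.
  by apply/norP; split; [apply: yM|apply: zM]; rewrite TS ?yS ?zS ?cy ?cz eqxx.
rewrite (card_clique_perms_on aS) EN //.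
rewrite (bigD1 (c x)) //= -/T (zeta_rec T0) big_distrl /=.
apply: eq_bigr => y yM; have /andP[yS /eqP cy] : (y \in S) && (c y == c x).
  by rewrite -TS; move: yM; rewrite inE => /andP[].
rewrite IH; last by move: Sn; rewrite (cardsD1 y) yS add1n ltnS.
rewrite (bigD1 (c x)) //= -setIDAC; congr (_ * _)%N.
apply: eq_bigr => j jx; congr zeta; apply/setP => z; rewrite !inE.
by case: (eqVneq z y) => [->|//]; rewrite cy eq_sym (negPf jx) !andbF.
Qed.

Lemma clique_perms_mono (s : {perm P}) :
  (s \in clique_perms inc_mono) =
  (s \in clique_perms (@inc d P)) && [forall x, c (s x) == c x].
Proof.
apply/clique_permsP/andP => [H|[/clique_permsP H /forallP cs] x y yx xy].
  split; first by apply/clique_permsP => x y yx /(H _ _ yx)/andP[].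
  apply/forallP => x; have [<-|xs] := eqVneq x (s x); first exact: eqxx.
  have : s x \in porbit s x by rewrite perm_porbit porbit_id.
  by move/H/(_ xs)/andP=> [_ /eqP->].
rewrite /inc_mono H //= eq_sym.
suff : y \in [set z | c z == c x] by rewrite inE.
apply: subsetP yx; apply: porbit_subset => [|z]; rewrite !inE ?eqxx //.
by rewrite (eqP (cs z)).
Qed.

Lemma card_clique_perms_mono :
  #|[set s in clique_perms (@inc d P) | [forall x, c (s x) == c x]]| =
  (\prod_j zeta (c @^-1: [set j]))%N.
Proof.
transitivity (\prod_j zeta ([set: P] :&: c @^-1: [set j]))%N; last first.
  by apply: eq_bigr => j _; rewrite setTI.
rewrite -card_clique_perms_on_mono clique_perms_onT.
by apply: eq_card => s; rewrite inE clique_perms_mono.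
Qed.

End Coloring.
End LinearExtensions.

Section Colorings.
Variables (R : comNzRingType) (n : nat).
Local Notation C := 'I_n.+1.
Variable X : C -> R.

Lemma prod_porbits_sum (V : finType) (s : {perm V}) :
  \prod_(B in porbits s) \sum_j X j ^+ #|B| =
  \sum_(c : {ffun V -> C} | [forall x, c (s x) == c x]) \prod_x X (c x).
Proof.
pose h (c : {ffun V -> C}) : {ffun {set V} -> C} :=
  [ffun B : {set V} => if [pick x | porbit s x == B] is Some x then c x else ord0].
pose h' (f : {ffun {set V} -> C}) : {ffun V -> C} := [ffun x => f (porbit s x)].
rewrite (big_distr_big ord0).
rewrite (reindex_onto h h') => [|f /pffun_onP[/subsetP f0 _]]; last first.
  apply/ffunP => B; rewrite ffunE; case: pickP => [x /eqP <-|nB]; first by rewrite ffunE.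
  apply/esym/eqP; apply: contraT => fB.
  have /imsetP[x _ Bx] := f0 B fB.
  by have := nB x; rewrite Bx eqxx.
have hE (c : {ffun V -> C}) x : [forall x, c (s x) == c x] -> h c (porbit s x) = c x.
  move=> /forallP cs; rewrite ffunE; case: pickP => [y|/(_ x)]; last by rewrite eqxx.
  rewrite eq_porbit_mem => yx; suff : y \in [set z | c z == c x] by rewrite inE => /eqP.
  apply: subsetP yx; apply: porbit_subset => [|z]; rewrite !inE ?eqxx //.
  by rewrite (eqP (cs z)).
apply: eq_big => c.
  apply/andP/idP => [[_ /eqP/ffunP hc]|cs].
    apply/forallP => x; rewrite -(hc (s x)) -(hc x) !ffunE.
    by rewrite -[s x]/((s ^+ 1)%g x) porbit_perm.
  split; last by apply/eqP/ffunP => x; rewrite ffunE hE.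
  apply/pffun_onP; split => //; apply/subsetP => B; rewrite inE ffunE.
  by case: pickP => [x /eqP <- _|_]; rewrite ?eqxx // imset_f.
case/andP=> _ /eqP/ffunP hc.
rewrite [RHS](partition_big (porbit s) (mem (porbits s))) => [|x _]; last exact: imset_f.
apply: eq_bigr => B /imsetP[x _ ->].
rewrite -[in RHS]big_filter -prodr_const big_filter.
rewrite [RHS](eq_bigl (mem (porbit s x))) => [|y]; last by rewrite eq_porbit_mem.
apply: eq_bigr => y; rewrite -eq_porbit_mem => /eqP yx.
by rewrite -(hc y) [h' _ y]ffunE yx.
Qed.

Variables (d : Order.disp_t) (P : finPOrderType d).
Implicit Type c : {ffun P -> C}.

Definition colors c := enum (c @: [set: P]).
Definition color_classes c := [seq c @^-1: [set e] | e <- colors c].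

Lemma mem_colors c x : c x \in colors c.
Proof. by rewrite mem_enum imset_f. Qed.

Lemma sorted_enum_ord (A : {set C}) : sorted ltn [seq val e | e <- enum A].
Proof.
rewrite sorted_map {1}/enum_mem sorted_filter //; first by move=> ? ? ?; apply: ltn_trans.
by rewrite -sorted_map -enumT val_enum_ord iota_ltn_sorted.
Qed.

Lemma set_composition_classes c : set_composition (color_classes c).
Proof.
apply/andP; split.
  rewrite map_inj_in_uniq ?enum_uniq // => e e'.
  rewrite !mem_enum => /imsetP[x _ ->] _ /setP/(_ x).
  by rewrite !inE eqxx => /esym/eqP.
apply/and3P; split.
- rewrite eqEsubset subsetT; apply/subsetP => x _; apply/bigcupP.
  by exists (c @^-1: [set c x]); rewrite !inE // map_f ?mem_colors.
- apply/trivIsetP => A B; rewrite !inE => /mapP[e _ ->] /mapP[e' _ ->] ee'.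
  rewrite -setI_eq0; apply/set0Pn => -[x]; rewrite !inE => /andP[/eqP xe /eqP xe'].
  by rewrite -xe -xe' eqxx in ee'.
rewrite inE; apply/mapP => -[e]; rewrite mem_enum => /imsetP[x _ ->] /setP/(_ x).
by rewrite !inE eqxx.
Qed.

Definition coloring (B : seq {set P}) (i : seq C) : {ffun P -> C} :=
  [ffun x => nth ord0 i (find (fun Y : {set P} => x \in Y) B)].

Lemma coloringK c : coloring (color_classes c) (colors c) = c.
Proof.
apply/ffunP => x; rewrite ffunE find_map.
rewrite (@eq_find _ _ (pred1 (c x))) => [|e]; last by rewrite /= !inE eq_sym.
exact: nth_index (mem_colors c x).
Qed.

Section ColoringOfComposition.
Variables (B : seq {set P}) (i : seq C).
Hypotheses (BP : set_composition B) (Bi : size B = size i).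
Hypothesis (si : sorted ltn [seq val e | e <- i]).

Let ui : uniq i.
Proof. by rewrite -(map_inj_uniq val_inj) (sorted_uniq ltn_trans ltnn). Qed.

Lemma coloring_preim j : (j < size B)%N ->
  coloring B i @^-1: [set nth ord0 i j] = nth set0 B j.
Proof.
case/andP: BP => uB /and3P[/eqP cB /trivIsetP tB B0] jB.
have fB x : (find (fun Y : {set P} => x \in Y) B < size B)%N.
  rewrite -has_find; have : x \in cover [set Y in B] by rewrite cB.
  by case/bigcupP => Y; rewrite inE => YB xY; apply/hasP; exists Y.
apply/setP => x; rewrite !inE ffunE nth_uniq -?Bi ?fB //.
have := nth_find set0 (_ : has (fun Y : {set P} => x \in Y) B).
rewrite has_find fB => /(_ isT) xf; apply/eqP/idP => [<- //|xj].
apply/eqP; rewrite -(nth_uniq set0 (fB x) jB uB); apply: contraTT xj => ne.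
have := tB _ _ _ _ ne; rewrite !inE !mem_nth // => /(_ isT isT).
by rewrite -setI_eq0 => /eqP/setP/(_ x); rewrite !inE xf /= => ->.
Qed.

Lemma colors_coloring : colors (coloring B i) = i.
Proof.
apply: (inj_map val_inj); apply: (irr_sorted_eq ltn_trans ltnn) => //.
  exact: sorted_enum_ord.
suff ci : colors (coloring B i) =i i.
  by move=> k; apply/mapP/mapP => -[e ei ->]; exists e; rewrite ?ci // -ci.
move=> e; rewrite mem_enum; apply/imsetP/idP => [[x _ ->]|ei].
  rewrite ffunE mem_nth // -Bi -has_find.
  case/andP: BP => _ /and3P[/eqP cB _ _].
  have : x \in cover [set Y in B] by rewrite cB.
  by case/bigcupP => Y; rewrite inE => YB xY; apply/hasP; exists Y.
have jB : (index e i < size B)%N by rewrite Bi index_mem.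
have /set0Pn[x] : nth set0 B (index e i) != set0.
  case/andP: BP => _ /and3P[_ _]; apply: contraNneq => <-.
  by rewrite inE mem_nth.
by rewrite -coloring_preim // !inE nth_index // => /eqP <-; exists x.
Qed.

Lemma classes_coloring : color_classes (coloring B i) = B.
Proof.
rewrite /color_classes colors_coloring.
apply: (@eq_from_nth _ set0) => [|j]; rewrite size_map // => ji.
by rewrite (nth_map ord0) // coloring_preim // Bi.
Qed.

End ColoringOfComposition.

Lemma size_colors c : size (colors c) = #|c @: [set: P]|.
Proof. by rewrite cardE. Qed.

Lemma sum_compositions_colorings (z : {set P} -> nat) : z set0 = 1%N ->
  \sum_(k < #|P|.+1) \sum_(B : k.-tuple {set P} | set_composition B)
    (\sum_(i : k.-tuple C | sorted ltn [seq val e | e <- i])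
      \prod_(j < k) X (tnth i j) ^+ #|tnth B j|) *+ \prod_(Y <- B) z Y =
  \sum_(c : {ffun P -> C}) (\prod_x X (c x)) *+ \prod_j z (c @^-1: [set j]).
Proof.
move=> z0.
rewrite [RHS](partition_big
  (fun c : {ffun P -> C} => inord #|c @: [set: P]| : 'I_#|P|.+1) predT) //=.
apply: eq_bigr => k _.
under eq_bigr do rewrite -sumrMnl.
rewrite pair_big_dep /=.
pose h (p : k.-tuple {set P} * k.-tuple C) := coloring p.1 p.2.
pose h' c : k.-tuple {set P} * k.-tuple C :=
  ([tuple nth set0 (color_classes c) j | j < k], [tuple nth ord0 (colors c) j | j < k]).
have kE c : (inord #|c @: [set: P]| == k) = (size (colors c) == k).
  by rewrite -val_eqE /= size_colors inordK // ltnS -cardsT leq_imset_card.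
have tE (T : Type) (x0 : T) (s : seq T) :
    size s = k -> [tuple nth x0 s j | j < k] = s :> seq T.
  move=> sk; apply: (@eq_from_nth _ x0) => [|j]; rewrite size_tuple //.
  by move=> jk; rewrite -[j]/(val (Ordinal jk)) -tnth_nth tnth_mktuple.
have h'1 c : size (colors c) = k -> (h' c).1 = color_classes c :> seq _.
  by move=> ck; rewrite tE // size_map.
have h'2 c : size (colors c) = k -> (h' c).2 = colors c :> seq _ by move=> ck; rewrite tE.
rewrite [RHS](reindex_onto h h') => [|c]; last first.
  by rewrite kE => /eqP ck; rewrite /h h'1 // h'2 // coloringK.
apply: eq_big => [[B i]|[B i]] /=.
  rewrite kE; apply/andP/andP => [[BP si]|[/eqP ck /eqP hB]].
    have Bi : size B = size i by rewrite !size_tuple.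
    have ck : size (colors (h (B, i))) = k by rewrite colors_coloring // size_tuple.
    rewrite ck eqxx; split=> //; apply/eqP; rewrite [h' _]surjective_pairing.
    congr pair; apply: val_inj; [apply: etrans (h'1 _ ck) _|apply: etrans (h'2 _ ck) _].
      exact: classes_coloring.
    exact: colors_coloring.
  have := h'1 _ ck; have := h'2 _ ck; rewrite hB /= => -> ->.
  by rewrite set_composition_classes sorted_enum_ord.
case/andP=> BP si; have Bi : size B = size i by rewrite !size_tuple.
have ci := colors_coloring BP Bi si; have cB := classes_coloring BP Bi si.
have cp := coloring_preim BP Bi si.
rewrite /h /=; set c := coloring B i in ci cB cp *; congr (_ *+ _).
  rewrite (partition_big c (mem (c @: [set: P]))) => [|x _]; last exact: imset_f.
  rewrite /= -[RHS]big_enum -/(colors c) ci big_tuple; apply: eq_bigr => j _.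
  rewrite (tnth_nth set0) -cp ?size_tuple //.
  rewrite -prodr_const; apply: eq_big => [x|x]; rewrite !inE (tnth_nth ord0) //.
  by move=> /eqP <-.
rewrite -{1}cB big_map /colors big_enum /= [RHS](bigID (mem (c @: [set: P]))) /=.
rewrite [X in (_ * X)%N]big1 ?muln1 // => e ec.
suff -> : c @^-1: [set e] = set0 by [].
by apply/setP => x; rewrite !inE; apply: contraNF ec => /eqP <-; rewrite imset_f.
Qed.

End Colorings.

Section Truncation.
Variables (F : fieldType) (n : nat).
Implicit Types (f g : fps F) (m : monom).

Definition low m := forall j, (n < j)%N -> m j = 0%N.

(* [f] and [g] have the same image under the specialization killing the
   variables of index greater than [n]. *)
Definition eq_low f g := forall m, low m -> f m = g m.

Lemma eq_lowD f f' g g' : eq_low f f' -> eq_low g g' -> eq_low (f + g) (f' + g').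
Proof. by move=> ff gg m lm; rewrite !fpsD ff // gg. Qed.

Lemma eq_lowM f f' g g' : eq_low f f' -> eq_low g g' -> eq_low (f * g) (f' * g').
Proof.
move=> ff gg m lm; rewrite !fpsM !big_seq; apply: eq_bigr => -[a b].
rewrite mem_splits => /eqP /= ab.
have [la lb] : low a /\ low b.
  by split=> j /lm/eqP; rewrite -ab cmM addn_eq0 => /andP[/eqP ? /eqP ?].
by rewrite ff // gg.
Qed.

Lemma eq_low_sum (I : Type) (r : seq I) (Q : pred I) (f g : I -> fps F) :
  (forall i, Q i -> eq_low (f i) (g i)) ->
  eq_low (\sum_(i <- r | Q i) f i) (\sum_(i <- r | Q i) g i).
Proof. by move=> fg; apply: (big_ind2 eq_low) => // *; apply: eq_lowD. Qed.

Lemma eq_low_prod (I : Type) (r : seq I) (Q : pred I) (f g : I -> fps F) :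
  (forall i, Q i -> eq_low (f i) (g i)) ->
  eq_low (\prod_(i <- r | Q i) f i) (\prod_(i <- r | Q i) g i).
Proof. by move=> fg; apply: (big_ind2 eq_low) => // *; apply: eq_lowM. Qed.

Lemma eq_lowMn f g k : eq_low f g -> eq_low (f *+ k) (g *+ k).
Proof.
by move=> fg; elim: k => [|k IH]; rewrite ?mulr0n // !mulrS; apply: eq_lowD.
Qed.

Lemma fps_sumE (I : Type) (r : seq I) (Q : pred I) (f : I -> fps F) m :
  (\sum_(i <- r | Q i) f i) m = \sum_(i <- r | Q i) f i m.
Proof. exact: (big_morph (fun f : fps F => f m)). Qed.

Lemma power_sum_low i : (0 < i)%N ->
  eq_low (power_sum F i) (\sum_(j < n.+1) var F j ^+ i).
Proof.
move=> i0 m lm; rewrite /power_sum /fps_sum fps_sumE.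
rewrite (fsbigE (iota 0 n.+1)) ?iota_uniq // => [|j _].
  rewrite -[iota _ _]/(index_iota 0 n.+1) big_mkord.
  by apply: eq_bigl => j; rewrite classical_sets.in_setT.
rewrite mem_iota add0n ltnS -ltnNge /= => nj; rewrite varX_mono /mono.
case: eqP => // mE; have := lm j nj; rewrite mE iter_ucm => i00.
by rewrite i00 in i0.
Qed.

Lemma qmonomial_low (k : nat) (al : seq nat) : size al = k -> all (leq 1) al ->
  eq_low (qmonomial F al)
    (\sum_(i : k.-tuple 'I_n.+1 | sorted ltn [seq val e | e <- i])
       \prod_(j < k) var F (tnth i j) ^+ nth 0%N al j).
Proof.
move=> <- {k} al0 m lm; rewrite /qmonomial /fps_sum fps_sumE.
pose v (i : (size al).-tuple 'I_n.+1) : (size al).-tuple nat := [tuple of map val i].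
have vI : injective v.
  by move=> i i' /(congr1 val)/(inj_map val_inj) ii'; apply: val_inj.
pose Q (i : (size al).-tuple 'I_n.+1) := sorted ltn [seq val e | e <- i].
rewrite (fsbigE [seq v i | i <- enum Q]) => [|||i].
- rewrite big_map big_enum_cond; apply: eq_big => [i|i _].
    apply/andP/idP => [[]//|Qi]; split => //.
    by apply/mem_set.
  by apply: (congr1 (fun f : fps F => f m)); apply: eq_bigr => j _; rewrite tnth_map.
- by rewrite map_inj_uniq ?enum_uniq.
- by move=> _ /= /mapP[i + ->]; rewrite mem_enum.
move=> si; apply: contraNeq; rewrite /qmonomial_term.
under eq_bigr do rewrite varX_mono.
rewrite mono_prod /mono; case: (m =P _) => [em _|]; last by rewrite eqxx.
have im j : (tnth i j < n.+1)%N.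
  rewrite ltnS leqNgt; apply/negP => /lm/eqP; rewrite em (bigD1 j) //= cmM iter_ucm.
  by rewrite addn_eq0 eqn0Ngt (allP al0) // mem_nth.
have iE : i = v [tuple Ordinal (im j) | j < size al].
  by apply: eq_from_tnth => j; rewrite tnth_map tnth_mktuple.
by rewrite iE map_f // mem_enum unfold_in /Q -[map _ _]/(val (v _)) -iE.
Qed.

End Truncation.

Lemma exists_low (m : monom) : exists n, low n m.
Proof.
exists (\max_(i <- finsupp m) i) => j nj; apply/eqP/contraT => mj.
have jm : j \in finsupp m by rewrite mem_finsupp.
by move: nj; rewrite ltnNge (leq_bigmax_seq (F := id) j jm isT).
Qed.

Lemma power_sum_part_cycle_type (F : fieldType) (V : finType) (s : {perm V}) :
  power_sum_part F (cycle_type s) = \prod_(B in porbits s) power_sum F #|B|.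
Proof.
rewrite /power_sum_part /cycle_type.
have /permPl/(perm_big _)-> := perm_sort geq [seq #|B| | B : {set V} <- enum (porbits s)].
by rewrite big_map big_enum.
Qed.

Theorem theorem4p15 (F : fieldType) (charF : [pchar F] =i pred0)
    (d : Order.disp_t) (P : finPOrderType d) (freeP : two_plus_two_free P) :
  linear_function P F =
    \sum_(sigma in clique_perms (@inc d P)) power_sum_part F (cycle_type sigma).
Proof.
apply/funext => m; have [n lm] := exists_low m.
pose X (j : 'I_n.+1) := var F j.
transitivity ((\sum_(c : {ffun P -> 'I_n.+1})
  (\prod_x X (c x)) *+ \prod_j zeta (c @^-1: [set j])) m).
  rewrite -sum_compositions_colorings ?zeta0 //.
  apply: eq_low_sum lm => k _; apply: eq_low_sum => B BP; apply: eq_lowMn.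
  have al0 : all (leq 1) [seq #|Y| | Y : {set P} <- B].
    apply/allP => _ /mapP[Y YB ->]; rewrite card_gt0.
    by case/andP: BP => _ /and3P[_ _]; apply: contraNneq => <-; rewrite inE.
  have sB : size [seq #|Y| | Y : {set P} <- B] = k by rewrite size_map size_tuple.
  move=> a la; rewrite (qmonomial_low F sB al0 la); apply: (congr1 (fun f : fps F => f a)).
  apply: eq_bigr => i _; apply: eq_bigr => j _.
  by rewrite (nth_map set0) ?size_tuple // (tnth_nth set0).
transitivity ((\sum_(s in clique_perms (@inc d P))
  \prod_(B in porbits s) \sum_j X j ^+ #|B|) m); last first.
  apply: eq_low_sum lm => s _; rewrite power_sum_part_cycle_type.
  apply: eq_low_prod => B /imsetP[x _ ->] a la; apply/esym/power_sum_low => //.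
  by rewrite card_gt0; apply/set0Pn; exists x; apply: porbit_id.
apply: (congr1 (fun f : fps F => f m)); under [RHS]eq_bigr do rewrite prod_porbits_sum.
rewrite (exchange_big_dep predT) //=; apply: eq_bigr => c _.
rewrite -card_clique_perms_mono // sumr_const; congr (_ *+ _).
by apply: eq_card => s; rewrite inE.
Qed.
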